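(* The weakly-Weyl curvature is a projective invariant in Finsler spaces. That is, let $M$ be a smooth manifold of dimension $n\ge 2$ and let $F$ and $\bar F$ be two projectively equivalent Finsler metrics on $M$. Then the weakly-Weyl curvatures of $F$ and $\bar F$ coincide: $\tilde W_j{}^i{}_{kl}=\bar{\tilde W}_j{}^i{}_{kl}$ on $TM\setminus\{0\}$.
   Context: Let $F$ be a Finsler metric on an $n$-dimensional manifold $M$ with standard local coordinates $(x^i,y^i)$ on $TM$; all tensors below live on $TM\setminus\{0\}$. A subscript ''$._k$'' denotes $\partial/\partial y^k$. The spray coefficients are $G^i=\frac14 g^{il}\{(F^2)_{x^ky^l}y^k-(F^2)_{x^l}\}$, where $g_{ij}=\frac12(F^2)_{y^iy^j}$. Two Finsler metrics $F,\bar F$ on $M$ are projectively equivalent if $G^i=\bar G^i+Py^i$ for some function $P=P(x,y)$ positively homogeneous of degree one in $y$; a quantity is a projective invariant if it is identical for any two projectively equivalent metrics. Riemann curvature: $R^i{}_k=2\frac{\partial G^i}{\partial x^k}-\frac{\partial^2G^i}{\partial x^m\partial y^k}y^m+2G^m\frac{\partial^2G^i}{\partial y^m\partial y^k}-\frac{\partial G^i}{\partial y^m}\frac{\partial G^m}{\partial y^k}$. Weyl curvature: $W^i{}_k=A^i{}_k-\frac1{n+1}A^m{}_{k.m}y^i$, where $A^i{}_k=R^i{}_k-R\,\delta^i{}_k$ and $R=\frac1{n-1}R^m{}_m$. Set $W_j{}^i{}_{pl}=\frac13\big(W^i{}_{p.l}-W^i{}_{l.p}\big)_{.j}$. Weakly-Weyl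 curvature: $\tilde W_j{}^i{}_{kl}=W_j{}^i{}_{pl.k}\,y^p$, where $W_j{}^i{}_{pl.k}=\partial W_j{}^i{}_{pl}/\partial y^k$. *)

(* Defs.v *)
From HB Require Import structures.
From mathcomp Require Import all_boot all_order all_algebra.
From mathcomp Require Import all_classical all_reals topology normedtype derive.

Set Implicit Arguments.
Unset Strict Implicit.
Unset Printing Implicit Defensive.

Import Order.TTheory GRing.Theory Num.Theory.
Import numFieldNormedType.Exports.

Local Open Scope classical_set_scope.
Local Open Scope ring_scope.

Section Smooth.
Context {R : realType} {V W : normedModType R}.

(* For an open set U of a finite-dimensional space V, being of class C^k on U. *)
Fixpoint class_C (k : nat) (U : set V) (f : V -> W) : Prop :=
  match k with
  | 0 => forall x, U x -> {for x, continuous f}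
  | k'.+1 => (forall x, U x -> differentiable f x) /\
             (forall v : V, class_C k' U (fun x => 'd f x v))
  end.

Definition smooth_on (U : set V) (f : V -> W) : Prop :=
  forall k, class_C k U f.

End Smooth.

Section Manifold.
Context {R : realType} {n : nat}.

(* The inverse is a total function; only its values on the image of the
   chart domain are meaningful. *)
Record chart (M : topologicalType) := Chart {
  chart_dom : set M;
  chart_map : M -> 'rV[R]_n;
  chart_inv : 'rV[R]_n -> M;
  chart_dom_open : open chart_dom;
  chart_codom_open : open (chart_map @` chart_dom);
  chart_mapK : {in chart_dom, cancel chart_map chart_inv};
  chart_map_continuous : {within chart_dom, continuous chart_map};
  chart_inv_continuous : {within chart_map @` chart_dom, continuous chart_inv}
}.

Definition chart_codom M (a : chart M) : set 'rV[R]_n :=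
  chart_map a @` chart_dom a.

Definition overlap M (a b : chart M) : set 'rV[R]_n :=
  chart_map a @` (chart_dom a `&` chart_dom b).

Definition transition M (a b : chart M) : 'rV[R]_n -> 'rV[R]_n :=
  fun x => chart_map b (chart_inv a x).

Record smooth_structure (M : topologicalType) := SmoothStructure {
  chart_index : Type;
  atlas : chart_index -> chart M;
  manifold_hausdorff : hausdorff_space M;
  manifold_second_countable : @second_countable M;
  atlas_cover : forall p : M, exists a, chart_dom (atlas a) p;
  atlas_smooth : forall a b,
    smooth_on (overlap (atlas a) (atlas b)) (transition (atlas a) (atlas b))
}.

(* TM is the gluing of the pieces (chart_codom a) x R^n along
   (x, y) ~ (transition x, d(transition)_x y), so a function on TM is a
   compatible family of functions of the local coordinates (x, y).  The
   parameter Y selects the part of TM under consideration: setT for TM,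
   [set y | y != 0] for TM minus the zero section. *)
Definition on_tangent_bundle (M : topologicalType) (S : smooth_structure M)
    (Y : set 'rV[R]_n) (f : chart_index S -> 'rV[R]_n -> 'rV[R]_n -> R) : Prop :=
  forall a b x y, overlap (atlas a) (atlas b) x -> Y y ->
    f b (transition (atlas a) (atlas b) x)
        ('d (transition (atlas a) (atlas b)) x y) = f a x y.

End Manifold.

Section LocalCurvature.
Context {R : realType} {n : nat}.

Local Notation tfun := ('rV[R]_n -> 'rV[R]_n -> R).

Definition Dx (k : 'I_n) (f : tfun) : tfun :=
  fun x y => 'D_(delta_mx 0 k) (fun z => f z y) x.

Definition Dy (k : 'I_n) (f : tfun) : tfun :=
  fun x y => 'D_(delta_mx 0 k) (fun z => f x z) y.

Definition sqF (F : tfun) : tfun := fun x y => F x y ^+ 2.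

Definition metric (F : tfun) (i j : 'I_n) : tfun :=
  fun x y => 2^-1 * Dy j (Dy i (sqF F)) x y.

Definition metric_inv (F : tfun) (i l : 'I_n) : tfun :=
  fun x y => invmx (\matrix_(a < n, b < n) metric F a b x y) i l.

Definition spray (F : tfun) (i : 'I_n) : tfun := fun x y =>
  4^-1 * \sum_(l < n) metric_inv F i l x y *
    (\sum_(k < n) Dy l (Dx k (sqF F)) x y * y 0 k - Dx l (sqF F) x y).

(* riemann F i k is R^i_k: here and below, upper indices of the (1,1)-tensors
   come first. *)
Definition riemann (F : tfun) (i k : 'I_n) : tfun := fun x y =>
  2 * Dx k (spray F i) x y
  - \sum_(m < n) Dx m (Dy k (spray F i)) x y * y 0 m
  + 2 * \sum_(m < n) spray F m x y * Dy m (Dy k (spray F i)) x y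
  - \sum_(m < n) Dy m (spray F i) x y * Dy k (spray F m) x y.

Definition ricci_scalar (F : tfun) : tfun := fun x y =>
  (n%:R - 1)^-1 * \sum_(m < n) riemann F m m x y.

Definition weyl_A (F : tfun) (i k : 'I_n) : tfun := fun x y =>
  riemann F i k x y - ricci_scalar F x y * (i == k)%:R.

Definition weyl (F : tfun) (i k : 'I_n) : tfun := fun x y =>
  weyl_A F i k x y
  - (n%:R + 1)^-1 * (\sum_(m < n) Dy m (weyl_A F m k) x y) * y 0 i.

(* weyl4 F j i p l is W_j^i_{pl}. *)
Definition weyl4 (F : tfun) (j i p l : 'I_n) : tfun := fun x y =>
  3^-1 * Dy j (fun u v => Dy l (weyl F i p) u v - Dy p (weyl F i l) u v) x y.

(* weakly_weyl F j i k l is the weakly-Weyl curvature with lower indices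
   j, k, l and upper index i. *)
Definition weakly_weyl (F : tfun) (j i k l : 'I_n) : tfun := fun x y =>
  \sum_(p < n) Dy k (weyl4 F j i p l) x y * y 0 p.

End LocalCurvature.

Section Finsler.
Context {R : realType} {n : nat} {M : topologicalType}.
Variable S : @smooth_structure R n M.

Local Notation tfamily := (chart_index S -> 'rV[R]_n -> 'rV[R]_n -> R).

Record finsler_metric (F : tfamily) : Prop := FinslerMetric {
  finsler_on_TM : on_tangent_bundle [set: 'rV[R]_n] F;
  finsler_ge0 : forall a x y, chart_codom (atlas a) x -> 0 <= F a x y;
  finsler_smooth : forall a,
    smooth_on [set z : 'rV[R]_n * 'rV[R]_n |
                chart_codom (atlas a) z.1 /\ z.2 != 0]
              (fun z => F a z.1 z.2);
  finsler_homogeneous : forall a x y (t : R), chart_codom (atlas a) x -> 0 < t ->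
    F a x (t *: y) = t * F a x y;
  finsler_posdef : forall a x y, chart_codom (atlas a) x -> y != 0 ->
    forall v : 'rV[R]_n, v != 0 ->
      0 < \sum_(i < n) \sum_(j < n) metric (F a) i j x y * v 0 i * v 0 j
}.

Definition projectively_equivalent (F Fbar : tfamily) : Prop :=
  exists P : tfamily,
    [/\ on_tangent_bundle [set y : 'rV[R]_n | y != 0] P,
        (forall a x y (t : R), chart_codom (atlas a) x -> y != 0 -> 0 < t ->
           P a x (t *: y) = t * P a x y) &
        (forall a x y, chart_codom (atlas a) x -> y != 0 ->
           forall i, spray (F a) i x y
                     = spray (Fbar a) i x y + P a x y * y 0 i)].

End Finsler.

(* Main.v *)
(* If G^i = Gbar^i + P y^i, then differentiating and using Euler's identities
   for P (degree 1) and Gbar (degree 2) gives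
     R^i_k = Rbar^i_k + E delta^i_k + tau_k y^i,
   with E and tau as in [proj_E] and [proj_tau] below, where tau is homogeneous
   of degree 1 in y and tau_k y^k = - E.  Taking the trace, the scalar R changes
   by E, so A^i_k changes by tau_k y^i; by Euler's identity for tau the vertical
   trace A^m_{k.m} changes by (n + 1) tau_k, and the two corrections cancel in
   the Weyl curvature W^i_k.  The weakly-Weyl curvature is built from W by
   vertical derivatives.  The factor P is smooth because it equals
   (G^i - Gbar^i) y^i / |y|^2. *)
Require Import Defs.
From HB Require Import structures.
From mathcomp Require Import all_boot all_order all_algebra.
From mathcomp Require Import all_classical all_reals topology normedtype.
From mathcomp Require Import landau derive ring.

Set Implicit Arguments.
Unset Strict Implicit.
Unset Printing Implicit Defensive.

Import Order.TTheory GRing.Theory Num.Theory.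
Import numFieldNormedType.Exports.
Local Open Scope classical_set_scope.
Local Open Scope ring_scope.

(** * Smooth functions *)

(** Differentiability depends only on the germ: the first-order expansion of [f] at [x] is also one
    of [g], and uniqueness of the differential identifies ['d g x] with ['d f x]. *)
Lemma near_eq_is_diff (R : realType) (V W : normedModType R) (f g : V -> W) x :
  {near x, f =1 g} -> differentiable f x -> is_diff x g ('d f x).
Proof.
move=> fg df.
have [dc dl] := (diff_locallyP _ _).1 df.
have dl' : g \o shift x = cst (g x) + 'd f x +o_ 0 id.
  apply/eqaddoP => e e0.
  have /eqaddoP /(_ e e0) := dl.
  have : \forall h \near 0, f (h + x) = g (h + x).
    have := fg; rewrite (near_shift 0 x)/=; apply: filterS => h.
    by rewrite /= subr0.
  apply: filterS2 => h /= fgh.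
  rewrite -[(_ - _) h]/(f (h + x) - (f x + 'd f x h)).
  rewrite -[(_ - _) h]/(g (h + x) - (g x + 'd f x h)).
  by rewrite fgh (nbhs_singleton fg).
have dE : 'd g x = 'd f x :> (V -> W).
  exact: (@diff_unique _ _ _ g ('d f x) x dc dl').
apply: DiffDef; last exact: dE.
by apply/diff_locallyP; rewrite dE; split; [exact: dc|exact: dl'].
Qed.

Lemma is_derive_comp_diff (R : realType) (V W Z : normedModType R)
    (g : V -> W) (f : W -> Z) x v dg :
  is_diff x g dg -> differentiable f (g x) ->
  is_derive x v (fun z => f (g z)) ('d f (g x) (dg v)).
Proof.
move=> [dgx gE] dfx; have dc := differentiable_comp dgx dfx.
apply: DeriveDef; first exact: diff_derivable dc.
apply: etrans (deriveE v dc) _.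
apply: etrans (congr1 (fun h => h v) (diff_comp dgx dfx)) _.
by rewrite /= gE.
Qed.

Section SmoothAlgebra.
Context {R : realType} {V : normedModType R} {U : set V} (oU : open U).

(** Since [U] is open, equality on [U] is equality near each of its points, so the differentials
    agree on [U] as well and the induction continues with ['d f x v] and ['d g x v] in place of [f]
    and [g]. *)
Lemma class_C_eq (W : normedModType R) k (f g : V -> W) :
  (forall x, U x -> f x = g x) -> class_C k U f -> class_C k U g.
Proof.
have nearU x (h1 h2 : V -> W) : U x -> (forall x, U x -> h1 x = h2 x) ->
    {near x, h1 =1 h2}.
  by move=> Ux h12; apply: filterS (open_nbhs_nbhs (conj oU Ux)) => z /h12.
elim: k f g => [|k IH] f g fg /=.
  move=> fc x Ux; have fgx := nearU _ _ _ Ux fg.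
  have fcx : f z @[z --> x] --> f x := fc _ Ux.
  suff : g z @[z --> x] --> g x by [].
  by rewrite -(fg _ Ux); apply: cvg_trans (near_eq_cvg fgx) fcx.
move=> [df Cf].
have dg x : U x -> is_diff x g ('d f x).
  by move=> Ux; apply: near_eq_is_diff (df _ Ux); exact: nearU.
split=> [x Ux|v]; first exact: (@ex_diff _ _ _ _ _ _ _ (dg x Ux)).
apply: IH (Cf v) => x Ux.
exact: (esym (congr1 (fun h => h v) (@diff_val _ _ _ _ _ _ _ (dg x Ux)))).
Qed.

Lemma class_CW (W : normedModType R) k (f : V -> W) :
  class_C k.+1 U f -> class_C k U f.
Proof.
elim: k f => [|k IH] f [df Cf]; last by split=> // v; exact: IH.
by move=> x /df; exact: differentiable_continuous.
Qed.

Lemma smooth_eq (W : normedModType R) (f g : V -> W) :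
  (forall x, U x -> f x = g x) -> smooth_on U f -> smooth_on U g.
Proof. by move=> fg sf k; apply: class_C_eq (sf k). Qed.

Lemma smooth_differentiable (W : normedModType R) (f : V -> W) x :
  smooth_on U f -> U x -> differentiable f x.
Proof. by move=> /(_ 1) [df _] /df. Qed.

Lemma smooth_diff (W : normedModType R) (f : V -> W) v :
  smooth_on U f -> smooth_on U (fun x => 'd f x v).
Proof. by move=> sf k; have [_ Cf] := sf k.+1; exact: Cf. Qed.

Lemma smooth_cst (W : normedModType R) (c : W) : smooth_on U (fun=> c).
Proof.
move=> k; elim: k c => [|k IH] c /=; first by move=> x _; exact: cst_continuous.
split=> [x _|v]; first exact: differentiable_cst.
by apply: class_C_eq (IH 0) => x _; rewrite diff_cst.
Qed.

Lemma smooth_linear (W : normedModType R) (f : {linear V -> W}) :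
  continuous f -> smooth_on U f.
Proof.
move=> fc [|k] /=; first by move=> x _; exact: fc.
split=> [x _|v]; first exact: linear_differentiable.
by apply: class_C_eq (smooth_cst (f v) k) => x _; rewrite diff_lin.
Qed.

Lemma class_CD (W : normedModType R) k (f g : V -> W) :
  class_C k U f -> class_C k U g -> class_C k U (fun x => f x + g x).
Proof.
elim: k f g => [|k IH] f g.
  move=> fc gc x Ux; exact: (cvgD (fc x Ux) (gc x Ux)).
move=> [df Cf] [dg Cg]; split=> [x Ux|v].
  exact: (differentiableD (df _ Ux) (dg _ Ux)).
apply: class_C_eq (IH _ _ (Cf v) (Cg v)) => x Ux.
exact: esym (congr1 (fun h => h v) (diffD (df _ Ux) (dg _ Ux))).
Qed.

(** By the Leibniz rule the differential is f dg + g df. The undifferentiated factors have one order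
    of regularity to spare, which [class_CW] gives up to match the induction hypothesis. *)
Lemma class_CM k (f g : V -> R) :
  class_C k U f -> class_C k U g -> class_C k U (fun x => f x * g x).
Proof.
elim: k f g => [|k IH] f g.
  move=> fc gc x Ux; exact: (cvgM (fc x Ux) (gc x Ux)).
move=> Cf1 Cg1; have [[df Cf] [dg Cg]] := (Cf1, Cg1).
split=> [x Ux|v]; first exact: (differentiableM (df _ Ux) (dg _ Ux)).
have Cfg := IH _ _ (class_CW Cf1) (Cg v).
have Cgf := IH _ _ (class_CW Cg1) (Cf v).
apply: class_C_eq (class_CD Cfg Cgf) => x Ux.
exact: esym (congr1 (fun h => h v) (diffM (df _ Ux) (dg _ Ux))).
Qed.

(** The differential of 1/f is -(1/f)^2 df, whose factor 1/f is of class C^k by the induction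
    hypothesis. *)
Lemma class_CV k (f : V -> R) : (forall x, U x -> f x != 0) ->
  class_C k U f -> class_C k U (fun x => (f x)^-1).
Proof.
move=> f0; elim: k => [|k IH].
  move=> fc x Ux; exact: (cvgV (f0 x Ux) (fc x Ux)).
move=> Cf1; have [df Cf] := Cf1.
split=> [x Ux|v]; first exact: (differentiableV (df _ Ux) (f0 _ Ux)).
have CV := IH (class_CW Cf1).
have C1 : class_C k U (fun=> -1 : R) := smooth_cst _ k.
apply: class_C_eq (class_CM (class_CM C1 (class_CM CV CV)) (Cf v)) => x Ux.
apply: etrans (esym (congr1 (fun h => h v) (diffV (df _ Ux) (f0 _ Ux)))).
rewrite mulN1r -invfM -expr2; exact: erefl.
Qed.

Lemma smooth_cstR (c : R) : smooth_on U (fun=> c : R).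
Proof. exact: smooth_cst. Qed.

Lemma smoothD (W : normedModType R) (f g : V -> W) :
  smooth_on U f -> smooth_on U g -> smooth_on U (fun x => f x + g x).
Proof. by move=> sf sg k; exact: class_CD. Qed.

Lemma smoothM (f g : V -> R) :
  smooth_on U f -> smooth_on U g -> smooth_on U (fun x => f x * g x).
Proof. by move=> sf sg k; exact: class_CM. Qed.

Lemma smoothV (f : V -> R) : (forall x, U x -> f x != 0) ->
  smooth_on U f -> smooth_on U (fun x => (f x)^-1).
Proof. by move=> f0 sf k; exact: class_CV. Qed.

Lemma smoothB (f g : V -> R) :
  smooth_on U f -> smooth_on U g -> smooth_on U (fun x => f x - g x).
Proof.
move=> sf sg; apply: smooth_eq (smoothD sf (smoothM (smooth_cstR (-1)) sg)).
by move=> x _; rewrite mulN1r.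
Qed.

Lemma smooth_sum (I : Type) (r : seq I) (P : pred I) (f : I -> V -> R) :
  (forall i, smooth_on U (f i)) ->
  smooth_on U (fun x => \sum_(i <- r | P i) f i x).
Proof.
move=> sf; elim: r => [|i r IH].
  by apply: smooth_eq (smooth_cstR 0) => x _; rewrite big_nil.
case Pi : (P i); last by apply: smooth_eq IH => x _; rewrite big_cons Pi.
by apply: smooth_eq (smoothD (sf i) IH) => x _; rewrite big_cons Pi.
Qed.

Lemma smooth_prod (I : Type) (r : seq I) (P : pred I) (f : I -> V -> R) :
  (forall i, smooth_on U (f i)) ->
  smooth_on U (fun x => \prod_(i <- r | P i) f i x).
Proof.
move=> sf; elim: r => [|i r IH].
  by apply: smooth_eq (smooth_cstR 1) => x _; rewrite big_nil.
case Pi : (P i); last by apply: smooth_eq IH => x _; rewrite big_cons Pi.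
by apply: smooth_eq (smoothM (sf i) IH) => x _; rewrite big_cons Pi.
Qed.

Lemma smooth_det n (A : V -> 'M[R]_n) :
  (forall i j, smooth_on U (fun x => A x i j)) ->
  smooth_on U (fun x => \det (A x)).
Proof.
(* The determinant unfolds to the Leibniz sum over permutations. *)
move=> sA; apply: smooth_sum => s; apply: smoothM; first exact: smooth_cstR.
by apply: smooth_prod => i; exact: sA.
Qed.

(** Cramer's rule: the inverse is the adjugate divided by the determinant, and both are polynomial
    in the entries. *)
Lemma smooth_invmx n (A : V -> 'M[R]_n) i j :
  (forall x, U x -> A x \in unitmx) ->
  (forall i j, smooth_on U (fun x => A x i j)) ->
  smooth_on U (fun x => invmx (A x) i j).
Proof.
move=> uA sA.
suff : smooth_on U (fun x => (\det (A x))^-1 * \adj (A x) i j).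
  by apply: smooth_eq => x Ux; rewrite /invmx uA// !mxE.
apply: smoothM; first apply: smoothV; last 1 first.
(* The adjugate transposes the cofactors, so its entry (i, j) deletes row [j] and column [i]. *)
- apply: smooth_eq (smoothM (smooth_cstR ((-1) ^+ (j + i)))
    (smooth_det (A := fun x => row' j (col' i (A x))) _)).
    by move=> x Ux; rewrite mxE.
  by move=> k l; apply: smooth_eq (sA (lift j k) (lift i l)) => x _; rewrite !mxE.
- by move=> x /uA; rewrite unitmxE unitfE.
- exact: smooth_det.
Qed.

End SmoothAlgebra.

(** * Partial derivatives and homogeneity on the slit tangent bundle *)

Section PartialDerivatives.
Context {R : realType} {n : nat} {D : set 'rV[R]_n} (oD : open D).

Local Notation tfun := ('rV[R]_n -> 'rV[R]_n -> R).
Implicit Types (f g : tfun) (x y : 'rV[R]_n) (i j k l m : 'I_n) (d e : int).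

Definition slit : set ('rV[R]_n * 'rV[R]_n) := [set z | D z.1 /\ z.2 != 0].

Definition tsmooth f := smooth_on slit (fun z => f z.1 z.2).

(** The degree is an integer because vertical differentiation lowers it by one and takes degree 0,
    that of [Dy k P], to degree -1. *)
Definition hom d f := forall x y (t : R), D x -> y != 0 -> 0 < t ->
  f x (t *: y) = t ^ d * f x y.

Lemma open_nonzero : open [set y : 'rV[R]_n | y != 0].
Proof.
have -> : [set y : 'rV[R]_n | y != 0] = ~` [set 0].
  by apply/seteqP; split=> y /= /eqP.
by apply/closed_openC/accessible_closed_set1/hausdorff_accessible/norm_hausdorff.
Qed.

Lemma open_slit : open slit.
Proof.
have -> : slit = (fst @^-1` D) `&` (snd @^-1` [set y | y != 0]) by [].
apply: openI; apply: open_comp => //.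
- by move=> z _; exact: cvg_fst.
- by move=> z _; exact: cvg_snd.
- exact: open_nonzero.
Qed.

(** Chain rule along the slices z -> (z, y) and z -> (x, z): partial derivatives are values of the
    joint differential on (v, 0) and (0, v). *)
Lemma tsmooth_is_derive f x y v : tsmooth f -> D x -> y != 0 ->
  is_derive x v (fun z => f z y) ('d (fun z => f z.1 z.2) (x, y) (v, 0)) /\
  is_derive y v (fun z => f x z) ('d (fun z => f z.1 z.2) (x, y) (0, v)).
Proof.
move=> sf hx y0.
have df := smooth_differentiable sf (conj hx y0 : slit (x, y)).
have dp1 : is_diff x (fun z => (z, y)) (fun z => (z, 0)).
  exact: (@is_diff_pair _ _ _ _ id id (cst y) 0).
have dp2 : is_diff y (fun z => (x, z)) (fun z => (0, z)).
  exact: (@is_diff_pair _ _ _ _ (cst x) 0 id id).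
split.
- exact: (is_derive_comp_diff (f := fun z => f z.1 z.2) v dp1 df).
- exact: (is_derive_comp_diff (f := fun z => f z.1 z.2) v dp2 df).
Qed.

Lemma tsmooth_differentiable_y f x y : tsmooth f -> D x -> y != 0 ->
  differentiable (f x) y.
Proof.
move=> sf hx y0.
apply: (@differentiable_comp _ _ _ _ (fun z => (x, z)) (fun z => f z.1 z.2)).
  exact: differentiable_pair.
exact: (smooth_differentiable sf (conj hx y0 : slit (x, y))).
Qed.

Lemma tsmooth_derivable_x f x y v : tsmooth f -> D x -> y != 0 ->
  derivable (fun z => f z y) x v.
Proof. by move=> sf hx y0; have [[]] := tsmooth_is_derive v sf hx y0. Qed.

Lemma tsmooth_derivable_y f x y v : tsmooth f -> D x -> y != 0 ->
  derivable (fun z => f x z) y v.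
Proof. by move=> sf hx y0; have [_ []] := tsmooth_is_derive v sf hx y0. Qed.

Lemma tsmooth_eq f g :
  (forall x y, D x -> y != 0 -> f x y = g x y) -> tsmooth f -> tsmooth g.
Proof.
by move=> fg; apply: (smooth_eq open_slit) => -[x y] [hx y0]; exact: fg.
Qed.

(** A partial derivative is the joint differential evaluated on a fixed vector, and [class_C] is
    defined by recursion on exactly such functions. *)
Lemma tsmooth_Dx k f : tsmooth f -> tsmooth (Dx k f).
Proof.
move=> sf; apply: (smooth_eq open_slit) (smooth_diff (delta_mx 0 k, 0) sf).
move=> [x y] [hx y0]; have [h _] := tsmooth_is_derive (delta_mx 0 k) sf hx y0.
by rewrite /= /Dx; exact: esym (@derive_val _ _ _ _ _ _ _ h).
Qed.

Lemma tsmooth_Dy k f : tsmooth f -> tsmooth (Dy k f).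
Proof.
move=> sf; apply: (smooth_eq open_slit) (smooth_diff (0, delta_mx 0 k) sf).
move=> [x y] [hx y0]; have [_ h] := tsmooth_is_derive (delta_mx 0 k) sf hx y0.
by rewrite /= /Dy; exact: esym (@derive_val _ _ _ _ _ _ _ h).
Qed.

Lemma tsmooth_cst (c : R) : tsmooth (fun _ _ => c).
Proof. exact: (smooth_cstR open_slit). Qed.

Lemma tsmoothD f g :
  tsmooth f -> tsmooth g -> tsmooth (fun x y => f x y + g x y).
Proof. exact: (smoothD open_slit). Qed.

Lemma tsmoothB f g :
  tsmooth f -> tsmooth g -> tsmooth (fun x y => f x y - g x y).
Proof. exact: (smoothB open_slit). Qed.

Lemma tsmoothM f g :
  tsmooth f -> tsmooth g -> tsmooth (fun x y => f x y * g x y).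
Proof. exact: (smoothM open_slit). Qed.

Lemma tsmoothV f : (forall x y, D x -> y != 0 -> f x y != 0) ->
  tsmooth f -> tsmooth (fun x y => (f x y)^-1).
Proof. by move=> f0; apply: (smoothV open_slit) => -[x y] [? ?]; exact: f0. Qed.

Lemma tsmooth_sum (I : Type) (r : seq I) (P : pred I) (f : I -> tfun) :
  (forall a, tsmooth (f a)) -> tsmooth (fun x y => \sum_(a <- r | P a) f a x y).
Proof. exact: (@smooth_sum _ _ _ open_slit). Qed.

Lemma tsmooth_coord i : tsmooth (fun _ y => y 0 i).
Proof.
pose c (z : 'rV[R]_n * 'rV[R]_n) : R := z.2 0 i.
have cl : linear c by move=> a u v; rewrite /c /= !mxE.
pose cM := GRing.isLinear.Build _ _ _ _ _ cl.
pose cL : {linear _ -> _} := HB.pack c cM.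
have := @smooth_linear _ _ _ open_slit _ cL; apply.
move=> z; apply: (@continuous_comp _ _ _ snd (fun y : 'rV[R]_n => y 0 i)).
  exact: cvg_snd.
exact: coord_continuous.
Qed.

(** Identities known only on the slit bundle can still be differentiated, because [D] and the set of
    nonzero vectors are open. *)
Lemma Dx_eq k f g x y : (forall x y, D x -> y != 0 -> f x y = g x y) ->
  D x -> y != 0 -> Dx k f x y = Dx k g x y.
Proof.
move=> fg hx y0; apply: near_eq_derive.
by apply: filterS (open_nbhs_nbhs (conj oD hx)) => z Dz; exact: fg.
Qed.

Lemma Dy_eq k f g x y : (forall x y, D x -> y != 0 -> f x y = g x y) ->
  D x -> y != 0 -> Dy k f x y = Dy k g x y.
Proof.
move=> fg hx y0; apply: near_eq_derive.
by apply: filterS (open_nbhs_nbhs (conj open_nonzero y0)) => z z0; exact: fg.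
Qed.

Lemma DxD k f g x y : tsmooth f -> tsmooth g -> D x -> y != 0 ->
  Dx k (fun u v => f u v + g u v) x y = Dx k f x y + Dx k g x y.
Proof. by move=> sf sg hx y0; apply: deriveD; exact: tsmooth_derivable_x. Qed.

Lemma DyD k f g x y : tsmooth f -> tsmooth g -> D x -> y != 0 ->
  Dy k (fun u v => f u v + g u v) x y = Dy k f x y + Dy k g x y.
Proof. by move=> sf sg hx y0; apply: deriveD; exact: tsmooth_derivable_y. Qed.

Lemma DxM k f g x y : tsmooth f -> tsmooth g -> D x -> y != 0 ->
  Dx k (fun u v => f u v * g u v) x y = f x y * Dx k g x y + g x y * Dx k f x y.
Proof. by move=> sf sg hx y0; apply: deriveM; exact: tsmooth_derivable_x. Qed.

Lemma DyM k f g x y : tsmooth f -> tsmooth g -> D x -> y != 0 ->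
  Dy k (fun u v => f u v * g u v) x y = f x y * Dy k g x y + g x y * Dy k f x y.
Proof. by move=> sf sg hx y0; apply: deriveM; exact: tsmooth_derivable_y. Qed.

Lemma Dx_sum k p (f : 'I_p -> tfun) x y :
  (forall m : 'I_p, tsmooth (f m)) ->
  D x -> y != 0 ->
  Dx k (fun u v => \sum_(m < p) f m u v) x y = \sum_(m < p) Dx k (f m) x y.
Proof.
move=> sf hx y0; rewrite /Dx -derive_sum; last first.
  by move=> i; exact: tsmooth_derivable_x.
by congr ('D__ _ _); apply/funext => z; rewrite fct_sumE.
Qed.

Lemma Dy_sum k p (f : 'I_p -> tfun) x y :
  (forall m : 'I_p, tsmooth (f m)) ->
  D x -> y != 0 ->
  Dy k (fun u v => \sum_(m < p) f m u v) x y = \sum_(m < p) Dy k (f m) x y.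
Proof.
move=> sf hx y0; rewrite /Dy -derive_sum; last first.
  by move=> i; exact: tsmooth_derivable_y.
by congr ('D__ _ _); apply/funext => z; rewrite fct_sumE.
Qed.

Lemma Dx_y k (g : 'rV[R]_n -> R) x y : Dx k (fun _ v => g v) x y = 0.
Proof. exact: derive_cst. Qed.

Lemma Dy_x k (g : 'rV[R]_n -> R) x y : Dy k (fun u _ => g u) x y = 0.
Proof. exact: derive_cst. Qed.

Lemma Dy_coord k i x y : Dy k (fun _ v => v 0 i) x y = (i == k)%:R.
Proof.
pose c (z : 'rV[R]_n) : R := z 0 i.
have cl : linear c by move=> a u v; rewrite /c /= !mxE.
pose cM := GRing.isLinear.Build _ _ _ _ _ cl.
pose cL : {linear _ -> _} := HB.pack c cM.
have cc : continuous cL by exact: coord_continuous.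
rewrite /Dy (@deriveE _ _ _ cL); last exact: linear_differentiable.
by rewrite diff_lin// /cL/= /c mxE eqxx.
Qed.

End PartialDerivatives.

Arguments slit {R n} D.
Arguments tsmooth {R n} D f.
Arguments hom {R n} D d f.

(** * Homogeneity in the fibre variable and Euler's identity *)

Section Homogeneity.
Context {R : realType} {n : nat} {D : set 'rV[R]_n} (oD : open D).

Local Notation tfun := ('rV[R]_n -> 'rV[R]_n -> R).
Local Notation tsmooth := (tsmooth D).
Local Notation hom := (hom D).
Implicit Types (f g : tfun) (x y : 'rV[R]_n) (i j k l m : 'I_n) (d e : int).

Lemma hom_eq d f g :
  (forall x y, D x -> y != 0 -> f x y = g x y) -> hom d f -> hom d g.
Proof.
move=> fg hf x y t hx y0 t0.
by rewrite -!fg// ?hf// scaler_eq0 negb_or (gt_eqF t0).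
Qed.

Lemma homD d f g : hom d f -> hom d g -> hom d (fun x y => f x y + g x y).
Proof. by move=> hf hg x y t *; rewrite hf// hg// mulrDr. Qed.

Lemma homN d f : hom d f -> hom d (fun x y => - f x y).
Proof. by move=> hf x y t *; rewrite hf// mulrN. Qed.

Lemma homM d e f g :
  hom d f -> hom e g -> hom (d + e) (fun x y => f x y * g x y).
Proof.
by move=> hf hg x y t hx y0 t0; rewrite hf// hg// expfzDr ?gt_eqF// mulrACA.
Qed.

Lemma hom_cst (c : R) : hom 0 (fun _ _ => c).
Proof. by move=> x y t *; rewrite expr0z mul1r. Qed.

Lemma hom_coord i : hom 1 (fun _ y => y 0 i).
Proof. by move=> x y t *; rewrite expr1z mxE. Qed.

Lemma hom_sum d (I : Type) (r : seq I) (P : pred I) (f : I -> tfun) :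
  (forall a, hom d (f a)) -> hom d (fun x y => \sum_(a <- r | P a) f a x y).
Proof.
by move=> hf x y t *; rewrite mulr_sumr; apply: eq_bigr => a _; rewrite hf.
Qed.

Lemma hom_Dx d k f : tsmooth f -> hom d f -> hom d (Dx k f).
Proof.
move=> sf hf x y t hx y0 t0; rewrite /Dx.
rewrite (@near_eq_derive _ _ _ _ (fun z => t ^ d * f z y)); last first.
  by apply: filterS (open_nbhs_nbhs (conj oD hx)) => z Dz; exact: hf.
by rewrite deriveZ//; exact: tsmooth_derivable_x.
Qed.

(** Differentiating f(x, t y) = t^d f(x, y) in y produces an extra factor t on the left, which
    accounts for the loss of one degree. *)
Lemma hom_Dy d k f : tsmooth f -> hom d f -> hom (d - 1) (Dy k f).
Proof.
move=> sf hf x y t hx y0 t0; rewrite /Dy; set v := delta_mx 0 k.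
have tn0 : t != 0 by rewrite gt_eqF.
have ty0 : t *: y != 0 by rewrite scaler_eq0 negb_or tn0.
have -> : 'D_v (f x) (t *: y) = t^-1 * 'D_v (fun z => f x (t *: z)) y.
  have ds : is_diff y ( *:%R t) ( *:%R t) by exact: is_diff_scaler.
  have df := tsmooth_differentiable_y sf hx ty0.
  have [_ ->] := is_derive_comp_diff v ds df.
  by rewrite (deriveE _ df) linearZ/= mulrA mulVf// mul1r.
rewrite (@near_eq_derive _ _ _ _ (fun z => t ^ d * f x z)); last first.
  by apply: filterS (open_nbhs_nbhs (conj open_nonzero y0)) => z z0; exact: hf.
rewrite deriveZ//; last exact: tsmooth_derivable_y.
by rewrite expfzDr// exprN1 [t ^ d * t^-1]mulrC mulrA.
Qed.

(** The derivative of t -> f(x, t y) at t = 1 is computed twice: by the chain rule, and from f(x, t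
    y) = t^d f(x, y). *)
Lemma euler (d : nat) f x y : tsmooth f -> hom d f -> D x -> y != 0 ->
  \sum_(m < n) y 0 m * Dy m f x y = d%:R * f x y.
Proof.
move=> sf hf hx y0.
have df := tsmooth_differentiable_y sf hx y0.
have -> : \sum_(m < n) y 0 m * Dy m f x y = 'D_y (f x) y.
  have dy u : 'd (f x) y u = \sum_(m < n) u 0 m * 'd (f x) y (delta_mx 0 m).
    rewrite [in LHS](row_sum_delta u) linear_sum.
    by apply: eq_bigr => m _; rewrite linearZ.
  rewrite (deriveE _ df) dy; apply: eq_bigr => m _.
  congr (_ * _); exact: (deriveE (delta_mx 0 m) df).
(* Since y + h y = (1 + h) y, the two difference quotients coincide. *)
have -> : 'D_y (f x) y = 'D_1 (fun t : R => f x (t *: y)) 1.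
  rewrite /derive scale1r.
  have E : (fun h : R => h^-1 *: ((f x \o shift y) (h *: y) - f x y)) =
      (fun h => h^-1 *: (((fun t => f x (t *: y)) \o shift 1) (h *: 1) - f x y)).
    by apply/funext => h /=; rewrite scalerDl scale1r [h *: 1]mulr1.
  by rewrite E.
rewrite (@near_eq_derive _ _ _ _ (fun t : R => t ^+ d * f x y)); last first.
  have gt0 : nbhs (1 : R) [set t | 0 < t].
    by apply: open_nbhs_nbhs; split; [exact: open_gt|exact: ltr01].
  by apply: filterS gt0 => t t0; exact: hf.
rewrite deriveMr; last exact: exprn_derivable.
by rewrite exp_derive expr1n /GRing.scale/= !mulr1 mulrC.
Qed.

End Homogeneity.

(** * Projective change of sprays *)

(* [ring] compares atoms up to conversion, which here would unfold derivatives
   and sums; they are abstracted first. *)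
Ltac ring_atoms :=
  repeat match goal with
  | |- context [@bigop.body ?A ?I ?z ?r ?F] => generalize (@bigop.body A I z r F)
  end;
  repeat match goal with
  | |- context [@Dx ?A ?p ?k ?f ?x ?y] => generalize (@Dx A p k f x y)
  | |- context [@Dy ?A ?p ?k ?f ?x ?y] => generalize (@Dy A p k f x y)
  end;
  intros; ring.

Section Curvature.
Context {R : realType} {n : nat} {D : set 'rV[R]_n} (oD : open D).

Local Notation tfun := ('rV[R]_n -> 'rV[R]_n -> R).
Local Notation tsmooth := (tsmooth D).
Local Notation hom := (hom D).
Implicit Types (f g : tfun) (x y : 'rV[R]_n) (i j k l m : 'I_n) (d e : int).

(* [riemann F] is convertible to [spray_curvature (spray F)].  For an abstract
   spray, unification cannot get lost in unfolding [spray]. *)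
Definition spray_curvature (G : 'I_n -> tfun) i k : tfun := fun x y =>
  2 * Dx k (G i) x y
  - \sum_(m < n) Dx m (Dy k (G i)) x y * y 0 m
  + 2 * \sum_(m < n) G m x y * Dy m (Dy k (G i)) x y
  - \sum_(m < n) Dy m (G i) x y * Dy k (G m) x y.

Lemma tsmooth_riemann F i k : (forall j, tsmooth (spray F j)) ->
  tsmooth (riemann F i k).
Proof.
move=> sG.
apply: (tsmoothB oD); first apply: (tsmoothD oD); first apply: (tsmoothB oD).
- by apply: (tsmoothM oD); [exact: tsmooth_cst|exact: tsmooth_Dx].
- apply: (tsmooth_sum oD) => m; apply: (tsmoothM oD); last exact: tsmooth_coord.
  by apply/(tsmooth_Dx oD)/(tsmooth_Dy oD).
- apply: (tsmoothM oD); first exact: tsmooth_cst.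
  apply: (tsmooth_sum oD) => m; apply: (tsmoothM oD) => //.
  by apply/(tsmooth_Dy oD)/(tsmooth_Dy oD).
- by apply: (tsmooth_sum oD) => m; apply: (tsmoothM oD); exact: tsmooth_Dy.
Qed.

Lemma tsmooth_weyl_A F i k : (forall j, tsmooth (spray F j)) ->
  tsmooth (weyl_A F i k).
Proof.
move=> sG; apply: (tsmoothB oD); first exact: tsmooth_riemann.
apply: (tsmoothM oD); last exact: tsmooth_cst.
apply: (tsmoothM oD); first exact: tsmooth_cst.
by apply: (tsmooth_sum oD) => m; exact: tsmooth_riemann.
Qed.

Lemma sum_deltal (a : 'I_n -> R) i : \sum_(m < n) a m * (i == m)%:R = a i.
Proof.
rewrite (bigD1 i)//= eqxx mulr1 big1 ?addr0// => m.
by rewrite eq_sym => /negbTE ->; rewrite mulr0.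
Qed.

Lemma sum_deltar (a : 'I_n -> R) i : \sum_(m < n) a m * (m == i)%:R = a i.
Proof. by rewrite -[RHS]sum_deltal; apply: eq_bigr => m _; rewrite eq_sym. Qed.

(** * Change of the spray curvature, and the correction terms E and tau *)

Section ProjectiveChange.
Context (G Gb : 'I_n -> tfun) (P : tfun).
Hypothesis sGb : forall i, tsmooth (Gb i).
Hypothesis hGb : forall i, hom 2 (Gb i).
Hypothesis sP : tsmooth P.
Hypothesis hP : hom 1 P.
Hypothesis GE : forall i x y, D x -> y != 0 ->
  G i x y = Gb i x y + P x y * y 0 i.

Let sPy i : tsmooth (fun x y => P x y * y 0 i).
Proof. by apply: (tsmoothM oD) => //; exact: tsmooth_coord. Qed.

Let sDyP k : tsmooth (Dy k P). Proof. exact: tsmooth_Dy. Qed.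

Let sDyPy i k : tsmooth (fun x y => Dy k P x y * y 0 i).
Proof. by apply: (tsmoothM oD) => //; exact: tsmooth_coord. Qed.

Let sDyGb i k : tsmooth (Dy k (Gb i)). Proof. exact: tsmooth_Dy. Qed.

Let sPd i k : tsmooth (fun x y => P x y * (i == k)%:R).
Proof. by apply: (tsmoothM oD) => //; exact: tsmooth_cst. Qed.

Let sy i : tsmooth (fun _ y => y 0 i). Proof. exact: tsmooth_coord. Qed.

Let sd i k : tsmooth (fun _ _ => (i == k)%:R). Proof. exact: tsmooth_cst. Qed.

Let sDyS i k : tsmooth (fun x y => Dy k P x y * y 0 i + P x y * (i == k)%:R).
Proof. exact: (tsmoothD oD (sDyPy i k) (sPd i k)). Qed.

Lemma Dx_spray k i x y : D x -> y != 0 ->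
  Dx k (G i) x y = Dx k (Gb i) x y + Dx k P x y * y 0 i.
Proof.
move=> hx hy; rewrite (Dx_eq oD k (GE i) hx hy) (DxD _ (sGb i) (sPy i) hx hy).
by rewrite (DxM _ sP (sy i) hx hy) Dx_y mulr0 add0r [y 0 i * _]mulrC.
Qed.

Lemma Dy_spray k i x y : D x -> y != 0 ->
  Dy k (G i) x y =
  Dy k (Gb i) x y + (Dy k P x y * y 0 i + P x y * (i == k)%:R).
Proof.
move=> hx hy; rewrite (Dy_eq k (GE i) hx hy) (DyD _ (sGb i) (sPy i) hx hy).
rewrite (DyM _ sP (sy i) hx hy) Dy_coord.
by rewrite [y 0 i * _]mulrC [P x y * _ + _]addrC.
Qed.

Lemma DxDy_spray m k i x y : D x -> y != 0 ->
  Dx m (Dy k (G i)) x y = Dx m (Dy k (Gb i)) x y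
    + Dx m (Dy k P) x y * y 0 i + Dx m P x y * (i == k)%:R.
Proof.
move=> hx hy; rewrite (Dx_eq oD m (@Dy_spray k i) hx hy).
rewrite (DxD _ (sDyGb i k) (sDyS i k) hx hy).
rewrite (DxD _ (sDyPy i k) (sPd i k) hx hy).
rewrite (DxM _ (sDyP k) (sy i) hx hy) (DxM _ sP (sd i k) hx hy).
by rewrite !Dx_y !mulr0 !add0r addrA [y 0 i * _]mulrC [_%:R * _]mulrC.
Qed.

Lemma DyDy_spray m k i x y : D x -> y != 0 ->
  Dy m (Dy k (G i)) x y = Dy m (Dy k (Gb i)) x y
    + Dy m (Dy k P) x y * y 0 i + Dy k P x y * (i == m)%:R
    + Dy m P x y * (i == k)%:R.
Proof.
move=> hx hy; rewrite (Dy_eq m (@Dy_spray k i) hx hy).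
rewrite (DyD _ (sDyGb i k) (sDyS i k) hx hy).
rewrite (DyD _ (sDyPy i k) (sPd i k) hx hy).
rewrite (DyM _ (sDyP k) (sy i) hx hy) (DyM _ sP (sd i k) hx hy) Dy_coord Dy_x.
by ring_atoms.
Qed.

(** This is P^2 - P_{|m} y^m, where the bar is the horizontal derivative of the spray [Gb]: by
    Euler's identity its connection term, contracted with y, is 2 Gb^m P_{.m}. *)
Definition proj_E : tfun := fun x y =>
  P x y ^+ 2 - \sum_(m < n) y 0 m * Dx m P x y
  + 2 * \sum_(m < n) Gb m x y * Dy m P x y.

(** Up to the order of mixed partial derivatives this is 3 (P_{|k} - P P_{.k}) + E_{.k}, with the
    same horizontal derivative as in [proj_E]. *)
Definition proj_tau k : tfun := fun x y =>
  2 * Dx k P x y - \sum_(m < n) y 0 m * Dx m (Dy k P) x y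
  + 2 * \sum_(m < n) Gb m x y * Dy m (Dy k P) x y
  - \sum_(m < n) Dy m P x y * Dy k (Gb m) x y - P x y * Dy k P x y.

Lemma euler_P x y : D x -> y != 0 ->
  \sum_(m < n) y 0 m * Dy m P x y = P x y.
Proof. by move=> hx hy; rewrite (euler (d := 1) sP hP hx hy) mul1r. Qed.

Lemma euler_DyP k x y : D x -> y != 0 ->
  \sum_(m < n) y 0 m * Dy m (Dy k P) x y = 0.
Proof.
move=> hx hy; rewrite (euler (d := 0) (sDyP k) _ hx hy) ?mul0r//.
exact: (hom_Dy (d := 1) k sP hP).
Qed.

Lemma euler_Gb i x y : D x -> y != 0 ->
  \sum_(m < n) y 0 m * Dy m (Gb i) x y = 2 * Gb i x y.
Proof. by move=> hx hy; rewrite (euler (d := 2) (sGb i)). Qed.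

Lemma euler_DyGb k i x y : D x -> y != 0 ->
  \sum_(m < n) y 0 m * Dy m (Dy k (Gb i)) x y = Dy k (Gb i) x y.
Proof.
move=> hx hy; rewrite (euler (d := 1) (sDyGb i k) _ hx hy) ?mul1r//.
exact: (hom_Dy (d := 2) k (sGb i) (@hGb i)).
Qed.

(** The terms of the curvature are expanded one by one. Every contraction with y^m collapses by an
    Euler identity, and what remains is sorted by the factors delta^i_k and y^i. *)
Lemma spray_curvature_proj i k x y : D x -> y != 0 ->
  spray_curvature G i k x y =
  spray_curvature Gb i k x y + proj_E x y * (i == k)%:R
    + proj_tau k x y * y 0 i.
Proof.
move=> hx hy; set dl := (i == k)%:R.
have S1 : \sum_(m < n) Dx m (Dy k (G i)) x y * y 0 m =
    \sum_(m < n) Dx m (Dy k (Gb i)) x y * y 0 m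
    + (\sum_(m < n) y 0 m * Dx m (Dy k P) x y) * y 0 i
    + (\sum_(m < n) y 0 m * Dx m P x y) * dl.
  rewrite !mulr_suml -!big_split/=; apply: eq_bigr => m _.
  by rewrite DxDy_spray// -/dl; ring_atoms.
have S2 : \sum_(m < n) G m x y * Dy m (Dy k (G i)) x y =
    \sum_(m < n) Gb m x y * Dy m (Dy k (Gb i)) x y
    + (\sum_(m < n) Gb m x y * Dy m (Dy k P) x y) * y 0 i
    + Gb i x y * Dy k P x y
    + (\sum_(m < n) Gb m x y * Dy m P x y) * dl
    + P x y * (Dy k (Gb i) x y + Dy k P x y * y 0 i + P x y * dl).
  (* To compare both sides summand by summand, the isolated terms become sums over m. The vanishing
     sum inside [yi] matches the products P y^m P_{.k.m} y^i. *)
  have Gi : Gb i x y * Dy k P x y =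
      (\sum_(m < n) Gb m x y * (i == m)%:R) * Dy k P x y by rewrite sum_deltal.
  have yi : Dy k P x y * y 0 i =
      (\sum_(m < n) y 0 m * Dy m (Dy k P) x y) * y 0 i
      + Dy k P x y * (\sum_(m < n) y 0 m * (i == m)%:R).
    by rewrite sum_deltal euler_DyP// mul0r add0r.
  have Pd : P x y * dl = (\sum_(m < n) y 0 m * Dy m P x y) * dl.
    by rewrite euler_P.
  rewrite Pd yi -euler_DyGb// Gi !mulr_suml !mulr_sumr -!big_split/=.
  rewrite mulr_sumr -!big_split/=; apply: eq_bigr => m _.
  by rewrite DyDy_spray// GE// -/dl; ring_atoms.
have S3 : \sum_(m < n) Dy m (G i) x y * Dy k (G m) x y =
    \sum_(m < n) Dy m (Gb i) x y * Dy k (Gb m) x y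
    + 2 * Gb i x y * Dy k P x y + 2 * P x y * Dy k (Gb i) x y
    + (\sum_(m < n) Dy m P x y * Dy k (Gb m) x y) * y 0 i
    + 3 * P x y * Dy k P x y * y 0 i + P x y ^+ 2 * dl.
  set s1 := \sum_(m < n) Dy m (Gb i) x y * _.
  set s2 := \sum_(m < n) Dy m P x y * _.
  (* These are the nine products of the two three-term expansions given by [Dy_spray]. Three of them
     contract to P P_{.k} y^i, whence the coefficient 3. *)
  rewrite (eq_bigr (fun m =>
    Dy m (Gb i) x y * Dy k (Gb m) x y
    + y 0 m * Dy m (Gb i) x y * Dy k P x y
    + Dy m (Gb i) x y * (m == k)%:R * P x y
    + Dy m P x y * Dy k (Gb m) x y * y 0 i
    + y 0 m * Dy m P x y * (Dy k P x y * y 0 i)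
    + Dy m P x y * (m == k)%:R * (P x y * y 0 i)
    + Dy k (Gb m) x y * (i == m)%:R * P x y
    + y 0 m * (i == m)%:R * (P x y * Dy k P x y)
    + (m == k)%:R * (i == m)%:R * P x y ^+ 2)); last first.
    by move=> m _; rewrite !Dy_spray//; ring_atoms.
  rewrite !big_split/= -!mulr_suml !sum_deltal !sum_deltar euler_Gb// euler_P//.
  by rewrite -/s1 -/s2 -/dl; ring_atoms.
(* The terms 2 Gb^i P_{.k} and 2 P Gb^i_{.k} cancel between 2 [u3] and [u4]. The coefficient of P
   P_{.k} y^i is 2 - 3 = -1, and that of P^2 delta^i_k is 2 - 1 = 1. *)
have alg (u1 u2 u3 u4 a1 a2 a3 a4 dP yPk yP gPk gP PG dG p pk g yi d : R) :
    u1 = a1 + dP * yi -> u2 = a2 + yPk * yi + yP * d ->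
    u3 = a3 + gPk * yi + g * pk + gP * d + p * (dG + pk * yi + p * d) ->
    u4 = a4 + 2 * g * pk + 2 * p * dG + PG * yi + 3 * p * pk * yi
      + p ^+ 2 * d ->
    2 * u1 - u2 + 2 * u3 - u4 = (2 * a1 - a2 + 2 * a3 - a4)
      + (p ^+ 2 - yP + 2 * gP) * d
      + (2 * dP - yPk + 2 * gPk - PG - p * pk) * yi.
  by move=> -> -> -> ->; ring.
exact: alg (Dx_spray k i hx hy) S1 S2 S3.
Qed.

Lemma proj_tau_trace x y : D x -> y != 0 ->
  \sum_(k < n) proj_tau k x y * y 0 k = - proj_E x y.
Proof.
move=> hx hy.
(* Euler's identity for P is differentiated in x^m, which gives the derivatives in the order used by
   [proj_tau]. *)
have DxE m : \sum_(k < n) y 0 k * Dx m (Dy k P) x y = Dx m P x y.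
  rewrite -(Dx_eq oD m (@euler_P) hx hy) (Dx_sum _ _ hx hy); last first.
    by move=> k; exact: (tsmoothM oD (sy k) (sDyP k)).
  apply: eq_bigr => k _; rewrite (DxM _ (sy k) (sDyP k) hx hy).
  by rewrite Dx_y mulr0 addr0.
(* Here the contracted index is that of the inner derivative, whereas [euler_DyP] contracts the
   outer one. Differentiating Euler's identity for P in y^m gives P_{.m} on both sides, and it
   cancels. *)
have DyE m : \sum_(k < n) y 0 k * Dy m (Dy k P) x y = 0.
  have : Dy m P x y = \sum_(k < n) y 0 k * Dy m (Dy k P) x y + Dy m P x y.
    rewrite -{1}(Dy_eq m (@euler_P) hx hy) (Dy_sum _ _ hx hy); last first.
      by move=> k; exact: (tsmoothM oD (sy k) (sDyP k)).
    rewrite -[X in _ + X](sum_deltar (fun k => Dy k P x y)) -big_split/=.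
    apply: eq_bigr => k _; rewrite (DyM _ (sy k) (sDyP k) hx hy).
    by rewrite Dy_coord.
  by move=> h; apply: (addIr (Dy m P x y)); rewrite add0r.
have T1 : \sum_(k < n) (\sum_(m < n) y 0 m * Dx m (Dy k P) x y) * y 0 k =
    \sum_(m < n) y 0 m * Dx m P x y.
  under eq_bigr => k _ do rewrite mulr_suml.
  rewrite exchange_big/=; apply: eq_bigr => m _.
  by rewrite -DxE mulr_sumr; apply: eq_bigr => k _; ring_atoms.
have T2 : \sum_(k < n) (\sum_(m < n) Gb m x y * Dy m (Dy k P) x y) * y 0 k = 0.
  under eq_bigr => k _ do rewrite mulr_suml.
  rewrite exchange_big/= big1// => m _.
  rewrite (eq_bigr (fun k => Gb m x y * (y 0 k * Dy m (Dy k P) x y))).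
    by rewrite -mulr_sumr DyE mulr0.
  by move=> k _; ring_atoms.
have T3 : \sum_(k < n) (\sum_(m < n) Dy m P x y * Dy k (Gb m) x y) * y 0 k =
    2 * \sum_(m < n) Gb m x y * Dy m P x y.
  under eq_bigr => k _ do rewrite mulr_suml.
  rewrite exchange_big/= mulr_sumr; apply: eq_bigr => m _.
  rewrite mulrA -euler_Gb// mulr_suml; apply: eq_bigr => k _; ring_atoms.
have split_sum (v a b c d e : 'I_n -> R) p :
    \sum_(k < n) (2 * a k - b k + 2 * c k - d k - p * e k) * v k =
    2 * (\sum_(k < n) v k * a k) - (\sum_(k < n) b k * v k)
    + 2 * (\sum_(k < n) c k * v k) - (\sum_(k < n) d k * v k)
    - p * (\sum_(k < n) v k * e k).
  rewrite !mulr_sumr -!sumrN -!big_split/=; apply: eq_bigr => k _; ring.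
have alg (a b c d e p g : R) : b = a -> c = 0 -> d = 2 * g -> e = p ->
    2 * a - b + 2 * c - d - p * e = - (p ^+ 2 - a + 2 * g).
  by move=> -> -> -> ->; ring.
exact: etrans (split_sum _ _ _ _ _ _ _)
  (alg _ _ _ _ _ _ _ T1 T2 T3 (euler_P hx hy)).
Qed.

Lemma tsmooth_proj_tau k : tsmooth (proj_tau k).
Proof.
apply: (tsmoothB oD); first apply: (tsmoothB oD); first apply: (tsmoothD oD);
  first apply: (tsmoothB oD).
- by apply: (tsmoothM oD); [exact: tsmooth_cst|exact: tsmooth_Dx].
- apply: (tsmooth_sum oD) => m; apply: (tsmoothM oD); first exact: tsmooth_coord.
  exact: tsmooth_Dx.
- apply: (tsmoothM oD); first exact: tsmooth_cst.
  apply: (tsmooth_sum oD) => m; apply: (tsmoothM oD) => //.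
  exact: tsmooth_Dy.
- by apply: (tsmooth_sum oD) => m; exact: (tsmoothM oD).
- exact: (tsmoothM oD).
Qed.

Lemma hom_proj_tau k : hom 1 (proj_tau k).
Proof.
have hDyP l : hom 0 (Dy l P) by exact: (hom_Dy (d := 1)).
apply: homD; first apply: homD; first apply: homD; first apply: homD.
- by apply: (@homM _ _ _ 0 1); [exact: hom_cst|exact: hom_Dx].
- apply/homN/hom_sum => m; apply: (@homM _ _ _ 1 0); first exact: hom_coord.
  exact: hom_Dx.
- apply: (@homM _ _ _ 0 1); first exact: hom_cst.
  (* Second vertical derivatives of P have degree -1, so the product with Gb^m has degree 2 - 1 =
     1. *)
  apply: hom_sum => m; apply: (@homM _ _ _ 2 (-1)) => //.
  exact: (hom_Dy (d := 0)).
- apply/homN/hom_sum => m; apply: (@homM _ _ _ 0 1) => //.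
  exact: (hom_Dy (d := 2)).
- by apply/homN; exact: (@homM _ _ _ 1 0).
Qed.

(** In (tau_k y^m)_{.m} the derivative of y^m gives tau_k once for each of the n indices, and
    Euler's identity in degree 1 gives it once more. *)
Lemma vertical_trace_proj (A Ab : 'I_n -> 'I_n -> tfun) k x y :
  (forall i, tsmooth (Ab i k)) ->
  (forall i x y, D x -> y != 0 ->
    A i k x y = Ab i k x y + proj_tau k x y * y 0 i) ->
  D x -> y != 0 ->
  \sum_(m < n) Dy m (A m k) x y =
  \sum_(m < n) Dy m (Ab m k) x y + (n%:R + 1) * proj_tau k x y.
Proof.
move=> sA AE hx hy; have st := tsmooth_proj_tau k.
have DA m : Dy m (A m k) x y = Dy m (Ab m k) x y
    + proj_tau k x y + y 0 m * Dy m (proj_tau k) x y.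
  rewrite (Dy_eq m (AE m) hx hy) (DyD _ (sA m) (tsmoothM oD st (sy m)) hx hy).
  by rewrite (DyM _ st (sy m) hx hy) Dy_coord eqxx mulr1 addrA.
rewrite (eq_bigr _ (fun m _ => DA m)) 2!big_split/=.
have alg (a b c t : R) :
    b = t *+ #|'I_n| -> c = 1%:R * t -> a + b + c = a + (n%:R + 1) * t.
  by move=> -> ->; rewrite card_ord -mulr_natl; ring.
exact: alg (sumr_const _ _) (euler (d := 1) st (@hom_proj_tau k) hx hy).
Qed.

End ProjectiveChange.

(** * Invariance of the Weyl and weakly-Weyl curvatures *)

Section WeylInvariance.
Context (F Fb P : tfun).
Hypothesis sGb : forall i, tsmooth (spray Fb i).
Hypothesis hGb : forall i, hom 2 (spray Fb i).
Hypothesis sP : tsmooth P.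
Hypothesis hP : hom 1 P.
Hypothesis GE : forall i x y, D x -> y != 0 ->
  spray F i x y = spray Fb i x y + P x y * y 0 i.
Hypothesis hn : (2 <= n)%N.

Let E := proj_E (spray Fb) P.
Let tau := proj_tau (spray Fb) P.

Lemma riemann_proj i k x y : D x -> y != 0 ->
  riemann F i k x y =
  riemann Fb i k x y + E x y * (i == k)%:R + tau k x y * y 0 i.
Proof. exact: (spray_curvature_proj sGb hGb sP hP GE). Qed.

(** The trace of the Riemann curvature changes by n E + tau_m y^m = (n - 1) E, and the normalisation
    of R removes the factor n - 1. *)
Lemma ricci_scalar_proj x y : D x -> y != 0 ->
  ricci_scalar F x y = ricci_scalar Fb x y + E x y.
Proof.
move=> hx hy.
have tr : \sum_(m < n) riemann F m m x y =
    \sum_(m < n) riemann Fb m m x y + n%:R * E x y - E x y.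
  rewrite -(proj_tau_trace sGb hGb sP hP hx hy) mulr_natl -[in _ *+ n](card_ord n).
  rewrite -sumr_const -!big_split/=; apply: eq_bigr => m _.
  by apply: etrans (riemann_proj m m hx hy) _; rewrite eqxx mulr1.
(* The bound on the dimension makes n - 1 invertible. *)
have n1 : n%:R - 1 != 0 :> R by rewrite subr_eq0 pnatr_eq1; case: n hn => [|[]].
apply: etrans (congr1 _ tr) _; rewrite /ricci_scalar.
by field.
Qed.

Lemma weyl_A_proj i k x y : D x -> y != 0 ->
  weyl_A F i k x y = weyl_A Fb i k x y + tau k x y * y 0 i.
Proof.
have alg (a b r s e d t : R) :
    a = b + e * d + t -> r = s + e -> a - r * d = b - s * d + t.
  by move=> -> ->; ring.
move=> hx hy.
exact: alg (riemann_proj i k hx hy) (ricci_scalar_proj hx hy).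
Qed.

Lemma weyl_proj i k x y : D x -> y != 0 -> weyl F i k x y = weyl Fb i k x y.
Proof.
have n1 : n%:R + 1 != 0 :> R by rewrite natr1 pnatr_eq0.
have alg (a b t c d v : R) : a = b + t * v -> c = d + (n%:R + 1) * t ->
    a - (n%:R + 1)^-1 * c * v = b - (n%:R + 1)^-1 * d * v.
  by move=> -> ->; field.
move=> hx hy; apply: alg (weyl_A_proj i k hx hy) _.
have sA j : tsmooth (weyl_A Fb j k) by exact: tsmooth_weyl_A.
exact: (vertical_trace_proj sGb hGb sP hP sA (fun j => @weyl_A_proj j k) hx hy).
Qed.

(** The equality of the Weyl curvatures passes through three vertical derivatives in turn. Each
    intermediate equality is therefore proved on the whole slit bundle, so that [Dy_eq] applies to
    it again. *)
Lemma weakly_weyl_proj j i k l x y : D x -> y != 0 ->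
  weakly_weyl F j i k l x y = weakly_weyl Fb j i k l x y.
Proof.
have subE (a b c d : R) : a = b -> c = d -> a - c = b - d by move=> -> ->.
have mulE (a b c : R) : a = b -> a * c = b * c by move=> ->.
have DW m q u v : D u -> v != 0 ->
    Dy m (weyl F i q) u v = Dy m (weyl Fb i q) u v.
  by apply: Dy_eq => {}u {}v; exact: weyl_proj.
have WB p u v : D u -> v != 0 ->
    Dy l (weyl F i p) u v - Dy p (weyl F i l) u v =
    Dy l (weyl Fb i p) u v - Dy p (weyl Fb i l) u v.
  by move=> hu hv; exact: subE (DW _ _ _ _ hu hv) (DW _ _ _ _ hu hv).
have W4 p u v : D u -> v != 0 -> weyl4 F j i p l u v = weyl4 Fb j i p l u v.
  move=> hu hv; have := congr1 ( *%R 3^-1) (Dy_eq j (WB p) hu hv).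
  exact.
have DW4 p u v : D u -> v != 0 ->
    Dy k (weyl4 F j i p l) u v = Dy k (weyl4 Fb j i p l) u v.
  by apply: Dy_eq => {}u {}v; exact: W4.
move=> hx hy; rewrite /weakly_weyl.
apply: eq_bigr => p _; exact: mulE (DW4 p x y hx hy).
Qed.

End WeylInvariance.

(** * Smoothness and homogeneity of the spray coefficients of a Finsler metric *)

Section SpraySmooth.
Context (F : tfun).
Hypothesis sF : tsmooth F.
Hypothesis hF : hom 1 F.
Hypothesis posF : forall x y, D x -> y != 0 -> forall v : 'rV[R]_n, v != 0 ->
  0 < \sum_(i < n) \sum_(j < n) metric F i j x y * v 0 i * v 0 j.

Lemma tsmooth_sqF : tsmooth (sqF F).
Proof.
by apply: (tsmooth_eq oD) (tsmoothM oD sF sF) => x y _ _; rewrite /sqF expr2.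
Qed.

Lemma hom_sqF : hom 2 (sqF F).
Proof.
apply: hom_eq (homM hF hF : hom 2 _) => x y _ _.
by rewrite /sqF expr2.
Qed.

Lemma tsmooth_metric i j : tsmooth (metric F i j).
Proof.
apply: (tsmoothM oD); first exact: tsmooth_cst.
exact: (tsmooth_Dy oD j (tsmooth_Dy oD i tsmooth_sqF)).
Qed.

Lemma hom_metric i j : hom 0 (metric F i j).
Proof.
have h1 : hom 1 (Dy i (sqF F)) := hom_Dy i tsmooth_sqF hom_sqF.
have h0 : hom 0 (Dy j (Dy i (sqF F))) :=
  hom_Dy j (tsmooth_Dy oD i tsmooth_sqF) h1.
exact: (homM (hom_cst 2^-1) h0).
Qed.

(** A nonzero vector in the kernel of g_{ij} would annihilate the quadratic form, against positive
    definiteness. *)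
Lemma metric_unitmx x y : D x -> y != 0 ->
  \matrix_(a < n, b < n) metric F a b x y \in unitmx.
Proof.
move=> hx hy; rewrite unitmxE unitfE; apply/det0P => -[v v0 vA].
(* [det0P] yields a row vector with v A = 0, so the sum over i must be taken first. *)
have := posF hx hy v0; rewrite exchange_big/= big1 ?ltxx// => j _.
rewrite -mulr_suml; have /rowP/(_ j) := vA; rewrite !mxE => e.
rewrite [X in X * _](_ : _ = 0) ?mul0r//.
by rewrite -[RHS]e; apply: eq_bigr => i _; rewrite mxE mulrC.
Qed.

Lemma tsmooth_metric_inv i j : tsmooth (metric_inv F i j).
Proof.
apply: (smooth_invmx (open_slit oD)
  (A := fun z => \matrix_(a < n, b < n) metric F a b z.1 z.2)) => [z [hx hy]|a b].
  exact: metric_unitmx.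
apply: (smooth_eq (open_slit oD)) (tsmooth_metric a b) => z _.
by rewrite mxE.
Qed.

Lemma hom_metric_inv i j : hom 0 (metric_inv F i j).
Proof.
move=> x y t hx hy t0; rewrite expr0z mul1r.
have E : \matrix_(a < n, b < n) metric F a b x (t *: y) =
    \matrix_(a < n, b < n) metric F a b x y.
  apply/matrixP => a b; rewrite [LHS]mxE [RHS]mxE.
  by apply: etrans (hom_metric a b hx hy t0) _; rewrite expr0z mul1r.
have := congr1 (fun A : 'M[R]_n => invmx A i j) E.
exact.
Qed.

Lemma tsmooth_spray i : tsmooth (spray F i).
Proof.
have sx k : tsmooth (Dx k (sqF F)) := tsmooth_Dx oD k tsmooth_sqF.
apply: (tsmoothM oD (tsmooth_cst oD 4^-1)); apply: (tsmooth_sum oD) => l.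
apply: (tsmoothM oD (tsmooth_metric_inv i l)).
apply: (tsmoothB oD _ (sx l)); apply: (tsmooth_sum oD) => k.
exact: (tsmoothM oD (tsmooth_Dy oD l (sx k)) (tsmooth_coord oD k)).
Qed.

(** The inverse metric has degree 0. In the bracket, (F^2)_{x^k y^l} y^k has degree 1 + 1 and
    (F^2)_{x^l} has degree 2. *)
Lemma hom_spray i : hom 2 (spray F i).
Proof.
have sx k : tsmooth (Dx k (sqF F)) := tsmooth_Dx oD k tsmooth_sqF.
have hDx k : hom 2 (Dx k (sqF F)) := hom_Dx oD k tsmooth_sqF hom_sqF.
have hDyDx l k : hom 1 (Dy l (Dx k (sqF F))) := hom_Dy l (sx k) (hDx k).
apply: (@homM _ _ D 0 2 _ _ (hom_cst 4^-1)); apply: hom_sum => l.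
apply: (@homM _ _ D 0 2 _ _ (hom_metric_inv i l)).
apply: (homD _ (homN (hDx l))); apply: hom_sum => k.
exact: (homM (hDyDx l k) (hom_coord k)).
Qed.

End SpraySmooth.

(** [projectively_equivalent] supplies P without any regularity. Contracting the relation with y^i
    expresses P as a quotient of smooth functions with denominator |y|^2. *)
Lemma tsmooth_projective_factor (G Gb : 'I_n -> tfun) P :
  (forall i, tsmooth (G i)) -> (forall i, tsmooth (Gb i)) ->
  (forall i x y, D x -> y != 0 -> G i x y = Gb i x y + P x y * y 0 i) ->
  tsmooth P.
Proof.
move=> sG sGb GE.
have n0 (y : 'rV[R]_n) : y != 0 -> \sum_(i < n) y 0 i * y 0 i != 0.
  apply: contra => /eqP; move=> /psumr_eq0P e; apply/eqP/rowP => i.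
  have /eqP := e (fun i _ => sqr_ge0 (y 0 i)) i isT.
  by rewrite mulf_eq0 orbb mxE => /eqP.
have sy := tsmooth_coord oD.
have sN : tsmooth (fun _ y => \sum_(i < n) y 0 i * y 0 i).
  by apply: (tsmooth_sum oD) => i; exact: (tsmoothM oD).
have sH : tsmooth (fun x y => \sum_(i < n) (G i x y - Gb i x y) * y 0 i).
  apply: (tsmooth_sum oD) => i.
  exact: (tsmoothM oD (tsmoothB oD (sG i) (sGb i)) (sy i)).
apply: (tsmooth_eq oD) (tsmoothM oD sH (tsmoothV oD _ sN)) => x y hx hy.
- rewrite (eq_bigr (fun i => P x y * (y 0 i * y 0 i))); last first.
    by move=> i _; rewrite GE// addrAC subrr add0r mulrA.
  by rewrite -mulr_sumr mulfK// n0.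
- exact: n0.
Qed.

End Curvature.

Theorem theorem2p1 (R : realType) (n : nat) (hn : (2 <= n)%N)
    (M : topologicalType) (S : @smooth_structure R n M)
    (F Fbar : chart_index S -> 'rV[R]_n -> 'rV[R]_n -> R)
    (hF : finsler_metric F) (hFbar : finsler_metric Fbar)
    (hproj : projectively_equivalent F Fbar) :
  forall (a : chart_index S) (x y : 'rV[R]_n), chart_codom (atlas a) x -> y != 0 ->
    forall j i k l : 'I_n,
      weakly_weyl (F a) j i k l x y = weakly_weyl (Fbar a) j i k l x y.
Proof.
(* The curvatures are computed in a single chart, so everything takes place over its open image
   [D]. *)
move=> a x y hx hy j i k l; pose D := chart_codom (atlas a).
have oD : open D by exact: chart_codom_open.
have spr (H : chart_index S -> 'rV[R]_n -> 'rV[R]_n -> R) m : finsler_metric H ->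
    tsmooth D (spray (H a) m) /\ hom D 2 (spray (H a) m).
  move=> hH; have sH : tsmooth D (H a) := finsler_smooth hH a.
  have hH1 : hom D 1 (H a).
    by move=> u v t hu _ t0; rewrite expr1z; exact: (finsler_homogeneous hH).
  have pH := @finsler_posdef _ _ _ _ _ hH a.
  by split; [exact: tsmooth_spray|exact: hom_spray].
have [P [_ hP GE]] := hproj.
have GE' m u v : D u -> v != 0 ->
    spray (F a) m u v = spray (Fbar a) m u v + P a u v * v 0 m.
  by move=> hu hv; exact: GE.
have sGb m := (spr _ m hFbar).1.
have sP := tsmooth_projective_factor oD (fun m => (spr _ m hF).1) sGb GE'.
have hP1 : hom D 1 (P a).
  by move=> u v t hu hv t0; rewrite expr1z; exact: hP.
exact: (weakly_weyl_proj oD sGb (fun m => (spr _ m hFbar).2) sP hP1 GE' hn).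
Qed.
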